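(* Let $F$ be a field, let $d_1,\ldots,d_r$ be nonnegative integers, and put $n = d_1 + d_2 + \cdots + d_r$. Let $B$ be the monomial complete intersection ring $$B = F[y_1,y_2,\ldots,y_r]/(y_1^{d_1+1}, y_2^{d_2+1},\ldots,y_r^{d_r+1}),$$ with its natural grading, and let $B_i$ denote its homogeneous component of degree $i$. Then for every integer $k$ with $0 \le k \le \lfloor n/2 \rfloor$ the multiplication map $$\times (y_1 + y_2 + \cdots + y_r)^{n-2k} : B_k \to B_{n-k}$$ is a bijection.
   Context: The natural grading on $B$ is the one induced by the standard grading of the polynomial ring, in which each variable has degree $1$. The map $\times f$ is $m \mapsto fm$.
   Formalization: The field F is additionally assumed to have characteristic 0 or characteristic greater than n; for an arbitrary field the claim fails, e.g. F = F_2, d = (1,1), k = 0, where (y_1+y_2)^2 = 0 in B. *)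

(* Defs.v *)
From HB Require Import structures.
From mathcomp Require Import all_boot all_algebra.
From mathcomp Require Import mpoly.
From mathcomp Require Import boolp classical_sets functions.

Set Implicit Arguments.
Unset Strict Implicit.
Unset Printing Implicit Defensive.

Import GRing.Theory.

Local Open Scope ring_scope.
Local Open Scope quotient_scope.
Local Open Scope classical_set_scope.

Section MonomialCompleteIntersection.
Context (F : fieldType) (r : nat) (d : 'I_r -> nat).

(* {ideal_quot _} needs a boolean predicate, hence the asbool brackets. *)
Definition mci_ideal : pred {mpoly F[r]} :=
  fun p => `[< exists q : 'I_r -> {mpoly F[r]},
                 p = \sum_(i < r) q i * 'X_i ^+ (d i).+1 >].

Lemma mci_idealr_closed : idealr_closed mci_ideal.
Proof.
split.
- apply/asboolP; exists (fun=> 0).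
  by rewrite big1 // => i _; rewrite mul0r.
- apply/negP => /asboolP[q] /(congr1 (meval (fun=> 0))).
  rewrite rmorph1 rmorph_sum big1 => [/eqP|i _]; first by rewrite oner_eq0.
  by rewrite rmorphM rmorphXn /= mevalXU expr0n mulr0.
- move=> a u v /asboolP[q ->] /asboolP[s ->]; apply/asboolP.
  exists (fun i => a * q i + s i).
  rewrite mulr_sumr -big_split /=; apply: eq_bigr => i _.
  by rewrite mulrDl mulrA.
Qed.

HB.instance Definition _ :=
  isIdealr.Build {mpoly F[r]} mci_ideal mci_idealr_closed.

Definition mci := {ideal_quot (mci_ideal : idealr {mpoly F[r]})}.

HB.instance Definition _ := GRing.ComNzRing.on mci.

Definition mci_pi (p : {mpoly F[r]}) : mci := \pi_({ideal_quot (mci_ideal : idealr {mpoly F[r]})}) p.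

Definition mci_var (i : 'I_r) : mci := mci_pi 'X_i.

Definition mci_comp (e : nat) : set mci :=
  mci_pi @` [set p | p \is e.-homog].

End MonomialCompleteIntersection.

Arguments mci : clear implicits.
Arguments mci_pi : clear implicits.
Arguments mci_var : clear implicits.
Arguments mci_comp : clear implicits.

(* Main.v *)
(** The ring [B] is the tensor product of the simple [sl_2]-modules with weights
  [d i], [L] being multiplication by [\sum_i y_i]: the lowering operator
  [D = \sum_i (d_i \partial_i - y_i \partial_i^2)] preserves the ideal, sends
  [y_i ^ j] to [j (d_i - j + 1) y_i ^ (j - 1)], and Euler's relation gives
  [D L - L D = n - 2 e] in degree [e].  Bijectivity of [L^(n - 2 k)] follows from
  this relation alone, without semisimplicity or dimension counts, since the
  integers one divides by are products of factors between [1] and [n], hence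
  invertible in [F]. *)
From HB Require Import structures.
Require Import Defs.
From mathcomp Require Import all_boot all_algebra.
From mathcomp Require Import mpoly.
From mathcomp Require Import boolp classical_sets functions.
From mathcomp Require Import zify ring.

Import GRing.Theory.
Local Open Scope ring_scope.

(** * Abstract [sl_2] argument on a graded additive group *)

Section GradedSl2.
Context (V : zmodType) (n : nat) (H : nat -> set V) (L D : {additive V -> V}).
Hypothesis H_sub : forall e x y, H e x -> H e y -> H e (x - y).
Hypothesis H_top : forall e x, (n < e)%N -> H e x -> x = 0.
Hypothesis L_H : forall e x, H e x -> H e.+1 (L x).
Hypothesis D_H : forall e x, H e.+1 x -> H e (D x).
Hypothesis D_H0 : forall x, H 0 x -> D x = 0.
Hypothesis comm_DL : forall e x, H e x ->
  D (L x) = L (D x) + x *~ (n%:Z - (2 * e)%:Z).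
Hypothesis mulrn_inj : forall c (x : V), (0 < c <= n)%N -> x *+ c = 0 -> x = 0.
Hypothesis mulrn_surj : forall c e (x : V), (0 < c <= n)%N -> H e x ->
  exists2 y, H e y & y *+ c = x.

Lemma raise_H m e x : H e x -> H (e + m) (iter m L x).
Proof.
by move=> Hx; elim: m => [|m IHm]; rewrite ?addn0 ?addnS //; apply: L_H.
Qed.

Lemma lower_H m e x : (m <= e)%N -> H e x -> H (e - m) (iter m D x).
Proof.
move=> le_me Hx; elim: m le_me => [|m IHm] lt_me; first by rewrite subn0.
by apply: D_H; rewrite -subSn // subSS; apply: IHm; apply: ltnW.
Qed.

Lemma iter0 (f : {additive V -> V}) m : iter m f 0 = 0.
Proof. by elim: m => //= m ->; rewrite raddf0. Qed.

Lemma iterB (f : {additive V -> V}) m : {morph iter m f : x y / x - y}.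
Proof. by move=> x y; elim: m => //= m ->; rewrite raddfB. Qed.

Lemma iterMn (f : {additive V -> V}) m x c : iter m f (x *+ c) = iter m f x *+ c.
Proof. by elim: m => //= m ->; rewrite raddfMn. Qed.

(** Moving [D] past each of the [m.+1] copies of [L] costs the weights [n - 2 (e + i)] for
    [i = 0, ..., m]; the integer is their sum. *)
Lemma lower_raise m e x : H e x ->
  D (iter m.+1 L x) = iter m.+1 L (D x)
    + iter m L x *~ (m.+1%:Z * (n%:Z - (2 * e + m)%:Z)).
Proof.
move=> Hx; elim: m => [|m IHm].
  by rewrite /= addn0 mul1r (comm_DL _ _ Hx).
rewrite iterS (comm_DL _ _ (raise_H m.+1 e x Hx)) IHm raddfD raddfMz -addrA.
by rewrite -[L (iter m L x)]iterS -[L (iter _ L _)]iterS -mulrzDr;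
  congr (_ + _ *~ _); lia.
Qed.

(** Mirror computation: [L w = 0] leaves only the commutators, and the integer is the sum of
    [2 (e - i) - n] for [i = 0, ..., j]. *)
Lemma raise_lower j e w : (e <= n)%N -> (j < e)%N -> H e w -> L w = 0 ->
  L (iter j.+1 D w) = iter j D w *~ (j.+1%:Z * ((2 * e)%:Z - (n + j)%:Z)).
Proof.
move=> le_en + Hw Lw; elim: j => [|j IHj] lt_je.
  have := comm_DL _ _ Hw; rewrite Lw raddf0 => /esym/eqP.
  by rewrite addr_eq0 => /eqP /= ->; rewrite -mulrNz; congr (_ *~ _); lia.
have := comm_DL _ _ (lower_H j.+1 e w (ltnW lt_je) Hw).
rewrite IHj 1?ltnW // raddfMz => /esym/eqP; rewrite -[D (iter _ _ _)]iterS.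
rewrite eq_sym -subr_eq => /eqP; rewrite -[D (iter _ _ _)]iterS => <-.
by rewrite -mulrzBr; congr (_ *~ _); lia.
Qed.

(* If [L^m.+1 x = 0] then [0 = L D L^m.+1 x = L^m.+2 (D x)], so [D x = 0] by
   induction on the degree, and [D L^m.+1 x] is then a nonzero multiple of
   [L^m x]. *)
Lemma raise_inj k m x : (m + 2 * k <= n)%N -> H k x -> iter m L x = 0 -> x = 0.
Proof.
elim: k m x => [|k IHk] m x; elim: m => [|m IHm] // le_n Hx Lx0.
all: have Dx : D x = 0.
all: try exact: D_H0.
all: try by apply: (IHk m.+2); [lia | exact: D_H | rewrite iterS;
  have /(congr1 L) := lower_raise m _ _ Hx;
  rewrite Lx0 raddf0 raddfD raddfMz -[L (iter m L x)]iterS Lx0 mul0rz addr0 raddf0].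
all: apply: IHm => //; first by lia.
all: have := lower_raise m _ _ Hx; rewrite Lx0 Dx raddf0 iter0 add0r => /esym.
all: move: le_n; set e := (2 * _)%N => le_n.
(* By [le_n] both factors lie between 1 and [n]; their product may exceed [n], so they are cancelled
   one at a time. *)
all: have -> : (m.+1%:Z * (n%:Z - (e + m)%:Z) = (m.+1 * (n - e - m))%N%:Z) by nia.
all: rewrite -pmulrn mulrnA => /mulrn_inj x0; apply: (mulrn_inj m.+1); last apply: x0.
all: lia.
Qed.

(* A vector [w] killed by [L] in degree [e] is a nonzero multiple of
   [L^j (D^j w)] as long as [j + n <= 2 e]. *)
Lemma highest_weight_raise j e w : (e <= n)%N -> (j + n <= 2 * e)%N -> H e w ->
  L w = 0 -> exists2 v, H (e - j) v & iter j L v = w.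
Proof.
move=> le_en le_j Hw Lw.
suff [v [Hv Lv <-]] : exists v, [/\ H e v, L v = 0 & iter j L (iter j D v) = w].
  by exists (iter j D v) => //; apply: lower_H => //; lia.
elim: j le_j => [|j IHj] le_j; first by exists w.
have [|v [Hv Lv <-]] := IHj; first by lia.
(* Dividing [v] by the two factors of the integer in [raise_lower] gives [z] with
   [L (D^j.+1 z) = D^j v]. *)
have [|y Hy yv] := mulrn_surj j.+1 e v _ Hv; first by lia.
have [|z Hz zy] := mulrn_surj (2 * e - n - j) e y _ Hy; first by lia.
have Lz : L z = 0.
  apply: (mulrn_inj (2 * e - n - j)); first by lia.
  apply: (mulrn_inj j.+1); first by lia.
  by rewrite -(raddfMn L) -(raddfMn L) zy yv.
exists z; split => //.
rewrite iterSr (raise_lower _ e) //; last by lia.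
have -> : (j.+1%:Z * ((2 * e)%:Z - (n + j)%:Z) = ((2 * e - n - j) * j.+1)%N%:Z) by lia.
by rewrite -pmulrn mulrnA -!iterMn zy yv.
Qed.

(* By induction from the top degree [L y = L^m.+1 z], so [L] kills
   [y - L^m z]. *)
Lemma raise_surj e m y : (e <= n)%N -> (m + n <= 2 * e)%N -> H e y ->
  exists2 x, H (e - m) x & iter m L x = y.
Proof.
move=> le_en; move def_t: (n - e)%N => t.
elim: t e m y le_en def_t => [|t IHt] e m y le_en def_t le_m Hy.
  (* Here [e = n], so [L y] lies above the top degree. *)
  apply: highest_weight_raise => //; apply: H_top (L_H _ _ Hy); lia.
have [||||z] := IHt e.+1 m.+1 (L y); [lia..| exact: L_H |].
rewrite subSS => Hz Lz.
have Hw : H e (y - iter m L z).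
  by apply: H_sub => //; rewrite -[e](@subnK m) ; [exact: raise_H | lia].
have [||||v Hv Lv] := highest_weight_raise m e (y - iter m L z); [by []..| |].
  by rewrite raddfB -[L (iter _ _ _)]iterS Lz subrr.
exists (z + v);
  last by rewrite -[v]opprK iterB -[- v]sub0r iterB iter0 sub0r opprK Lv addrC subrK.
(* Only closure under subtraction is assumed, so [z + v] is read as [z - (0 - v)] with
   [0 = v - v]. *)
rewrite -[v]opprK -[- v]sub0r; apply: H_sub => //; apply: H_sub => //.
by rewrite -(subrr v); apply: H_sub.
Qed.

Lemma raise_bij k : (k <= n %/ 2)%N ->
  set_bij (H k) (H (n - k)) (iter (n - 2 * k) L).
Proof.
move=> le_k; split.
- move=> x Hx /=; have -> : (n - k = k + (n - 2 * k))%N by lia.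
  exact: raise_H.
- move=> x y /set_mem Hx /set_mem Hy /eqP; rewrite -subr_eq0 -iterB => /eqP L0.
  have Hxy := H_sub _ _ _ Hx Hy.
  by apply/eqP; rewrite -subr_eq0; apply/eqP; apply: raise_inj _ Hxy L0; lia.
- move=> y Hy; have [||x] := raise_surj (n - k) (n - 2 * k) y _ _ Hy; [lia..|].
  have -> : (n - k - (n - 2 * k) = k)%N by lia.
  by move=> Hx Lx; exists x.
Qed.

End GradedSl2.

(** * Derivatives of homogeneous polynomials and Euler's relation *)

Section HomogeneousDerivative.
Context (R : comNzRingType) (r : nat).
Implicit Types p q : {mpoly R[r]}.

Lemma homog_ind (P : {mpoly R[r]} -> Prop) e :
    P 0 -> (forall p q, P p -> P q -> P (p + q)) ->
    (forall c m, mdeg m = e -> P (c *: 'X_[m])) ->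
  forall p, p \is e.-homog -> P p.
Proof.
move=> P0 PD PX p /dhomogP hp; rewrite (mpolyE p) big_seq.
by apply: big_ind => // m /hp; apply: PX.
Qed.

Lemma mderiv_homog i e p : p \is e.-homog -> p^`M(i) \is e.-1.-homog.
Proof.
move=> /dhomogP hp; apply/dhomogP => m; rewrite mcoeff_msupp mcoeff_mderiv => nz.
suff /hp <- : (m + U_(i))%MM \in msupp p by rewrite /= mdegD mdeg1 addn1.
by rewrite mcoeff_msupp; apply: contraNneq nz => ->; rewrite mul0rn.
Qed.

Lemma mderiv_homog0 i p : p \is 0.-homog -> p^`M(i) = 0.
Proof.
move=> /dhomogP hp; apply/mpolyP => m; rewrite mcoeff_mderiv mcoeff0.
have [/hp|/memN_msupp_eq0 -> //] := boolP ((m + U_(i))%MM \in msupp p);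
  last by rewrite mul0rn.
by rewrite /= mdegD mdeg1 addn1.
Qed.

Lemma euler_homog e p : p \is e.-homog -> \sum_(i < r) 'X_i * p^`M(i) = p *+ e.
Proof.
move: p; apply: homog_ind => [|p q hp hq|c m def_e].
- by rewrite mul0rn big1 // => i _; rewrite linear0 mulr0.
- rewrite mulrnDl -hp -hq -big_split; apply: eq_bigr => i _ /=.
  by rewrite linearD mulrDr.
rewrite -def_e mdegE -mulr_natr natr_sum mulr_sumr; apply: eq_bigr => i _.
rewrite linearZ /= mderivX; have [-> |m_gt0] := posnP (m i).
  by rewrite scale0r scaler0 !mulr0.
rewrite -!scalerAr -mpolyXD addmC submK; last by rewrite lep1mP -lt0n.
by rewrite mulr_natr scaler_nat scalerMnr.
Qed.

Lemma mderivXU i j : ('X_j : {mpoly R[r]})^`M(i) = (i == j)%:R.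
Proof.
rewrite mderivX mnm1E eq_sym; case: eqVneq => [->|_]; last by rewrite scale0r.
have -> : (U_(j) - U_(j))%MM = 0%MM :> 'X_{1.. r}.
  by apply/mnmP => k; rewrite mnmBE subnn mnm0E.
by rewrite scale1r mpolyX0.
Qed.

Lemma mderiv_exp i p k : (p ^+ k)^`M(i) = p ^+ k.-1 * p^`M(i) *+ k.
Proof.
elim: k => [|k IHk]; first by rewrite expr0 -mpolyC1 mderivC mulr0n.
rewrite exprS mderivM IHk; case: k {IHk} => [|k]; first by rewrite /=; ring.
by rewrite /= -[in RHS]mulr_natl -mulr_natl exprS; ring.
Qed.

End HomogeneousDerivative.

(** * The lowering operator and its descent to the quotient ring *)

Section Lowering.
Context (F : fieldType) (r : nat) (d : 'I_r -> nat).
Implicit Types p q : {mpoly F[r]}.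

Definition mlower p :=
  \sum_(i < r) ((d i)%:R * p^`M(i) - 'X_i * p^`M(i)^`M(i)).

Lemma mlower_is_zmod_morphism : zmod_morphism mlower.
Proof.
move=> p q; rewrite /mlower -sumrB; apply: eq_bigr => i _.
by rewrite !linearB /=; ring.
Qed.

HB.instance Definition _ := GRing.isZmodMorphism.Build {mpoly F[r]} {mpoly F[r]}
  mlower mlower_is_zmod_morphism.

(** Leibniz rule with every partial derivative of the linear form equal to 1: the first-order terms
    produce the [d i], the second-order ones the factor 2. *)
Lemma mlower_mulXsum p : mlower ((\sum_(i < r) 'X_i) * p) =
  (\sum_(i < r) 'X_i) * mlower p + p *+ (\sum_(i < r) d i)
    - (\sum_(i < r) 'X_i * p^`M(i)) *+ 2.
Proof.
set l := \sum_(i < r) 'X_i.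
have dl i : l^`M(i) = 1.
  rewrite linear_sum (bigD1 i) //= mderivXU eqxx big1 ?addr0 // => j ne_ji.
  by rewrite mderivXU eq_sym (negbTE ne_ji).
rewrite mulr_sumr -sumrMnr -sumrMnl -big_split -sumrB /=; apply: eq_bigr => i _.
by rewrite !mderivM dl mul1r linearD /= mderivM dl -[p *+ d i]mulr_natl; ring.
Qed.

Lemma ideal_mulX i q : q * 'X_i ^+ (d i).+1 \in mci_ideal d.
Proof.
apply/asboolP; exists (fun j => if j == i then q else 0).
by rewrite (bigD1 i) //= eqxx big1 ?addr0 // => j /negbTE ->; rewrite mul0r.
Qed.

(** The coefficients [d i] are chosen for this: on [y_j ^ (d_j + 1)] the two terms of the operator
    cancel. For [i != j] that power is constant under the derivative in [y_i]. *)
Lemma ideal_mlower p : p \in mci_ideal d -> mlower p \in mci_ideal d.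
Proof.
move=> /asboolP[q ->]; rewrite raddf_sum; apply: rpred_sum => j _.
apply: rpred_sum => i _.
have [->|ne_ij] := eqVneq i j.
  have : 'X_j * ('X_j ^+ d j)^`M(j) = (d j)%:R * 'X_j ^+ d j :> {mpoly F[r]}.
    rewrite mderiv_exp mderivXU eqxx mulr1; case: (d j) => [|k].
      by rewrite !mulr0n; ring.
    by rewrite /= -mulr_natl exprS; ring.
  set u := 'X_j ^+ d j => Xu.
  (* The coefficient of the first derivative of [q j] is [d_j - 2 (d_j + 1) = - (d_j + 2)]. *)
  suff -> : (d j)%:R * (q j * 'X_j ^+ (d j).+1)^`M(j)
      - 'X_j * (q j * 'X_j ^+ (d j).+1)^`M(j)^`M(j)
    = (- (d j).+2%:R * (q j)^`M(j) - 'X_j * (q j)^`M(j)^`M(j)) * 'X_j ^+ (d j).+1.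
    exact: ideal_mulX.
  have du : ('X_j ^+ (d j).+1)^`M(j) = (d j).+1%:R * u.
    by rewrite mderiv_exp mderivXU eqxx mulr1 mulr_natl.
  have dn : ((d j).+1%:R : {mpoly F[r]})^`M(j) = 0 by rewrite -mpolyC_nat mderivC.
  rewrite mderivM du mderivD !mderivM du dn exprS -/u.
  by ring: Xu.
have dX0 : ('X_j ^+ (d j).+1)^`M(i) = 0 :> {mpoly F[r]}.
  by rewrite mderiv_exp mderivXU (negbTE ne_ij) mulr0 mul0rn.
rewrite !(mderivM, dX0, mulr0, addr0) !mulrA -mulrBl.
exact: ideal_mulX.
Qed.

Lemma mlower_homog e p : p \is e.+1.-homog -> mlower p \is e.-homog.
Proof.
move=> hp; apply: rpred_sum => i _.
have hp1 : p^`M(i) \is e.-homog := mderiv_homog _ _ i _ _ hp.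
apply: rpredB; first by rewrite mulr_natl; apply: rpredMn.
(* For [e = 0] the truncated degree of the second derivative would give a product of degree 1; that
   derivative is in fact zero. *)
case: e hp1 {hp} => [|e] hp1;
  first by rewrite (mderiv_homog0 _ _ i _ hp1) mulr0 rpred0.
rewrite -[e.+1]add1n; apply: dhomogM; last exact: mderiv_homog hp1.
by rewrite dhomogX /= mdeg1.
Qed.

Lemma mlower_homog0 p : p \is 0.-homog -> mlower p = 0.
Proof.
move=> hp; rewrite /mlower big1 // => i _.
by rewrite (mderiv_homog0 _ _ i _ hp) linear0 !mulr0 subr0.
Qed.

(** Pigeonhole: a monomial of such a degree has some exponent [m i > d i]. *)
Lemma homog_ideal e p :
  (\sum_(i < r) d i < e)%N -> p \is e.-homog -> p \in mci_ideal d.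
Proof.
move=> lt_de; move: p; apply: homog_ind => [|p q|c m def_e].
- exact: rpred0.
- exact: rpredD.
have [i lt_dm] : exists i, (d i < m i)%N.
  apply/existsP; apply: contraTT lt_de; rewrite negb_exists => /forallP le_md.
  by rewrite -leqNgt -def_e mdegE; apply: leq_sum => i _; rewrite leqNgt.
rewrite -mul_mpolyC; apply: idealMr.
suff -> : 'X_[m] = 'X_[m - U_(i) *+ (d i).+1] * 'X_i ^+ (d i).+1 :> {mpoly F[r]}.
  exact: ideal_mulX.
rewrite mpolyXn -mpolyXD submK //.
apply/mnm_lepP => j; rewrite mulmnE mnm1E.
by case: eqVneq => [<-|_]; rewrite ?mul1n ?mul0n.
Qed.

Local Open Scope quotient_scope.

Lemma mci_pi_is_zmod_morphism : zmod_morphism (mci_pi F r d).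
Proof. by move=> p q; rewrite /mci_pi rmorphB. Qed.

HB.instance Definition _ := GRing.isZmodMorphism.Build {mpoly F[r]} (mci F r d)
  (mci_pi F r d) mci_pi_is_zmod_morphism.

Lemma mci_piM : {morph mci_pi F r d : p q / p * q}.
Proof. by move=> p q; rewrite /mci_pi rmorphM. Qed.

Lemma mci_piE p q : (mci_pi F r d p = mci_pi F r d q) <-> p - q \in mci_ideal d.
Proof.
rewrite (Quotient.idealrBE (mci_ideal d : idealr {mpoly F[r]})).
by split=> /eqP.
Qed.

Definition mci_lower (x : mci F r d) : mci F r d := mci_pi F r d (mlower (repr x)).

Lemma mci_lower_pi p : mci_lower (mci_pi F r d p) = mci_pi F r d (mlower p).
Proof.
apply/mci_piE; rewrite -raddfB; apply: ideal_mlower.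
apply/mci_piE; exact: reprK.
Qed.

Lemma mci_lower_is_zmod_morphism : zmod_morphism mci_lower.
Proof.
move=> x y; rewrite -[x]reprK -[y]reprK -!/(mci_pi F r d _).
by rewrite -raddfB !mci_lower_pi !raddfB.
Qed.

HB.instance Definition _ := GRing.isZmodMorphism.Build (mci F r d) (mci F r d)
  mci_lower mci_lower_is_zmod_morphism.

Definition mci_raise (x : mci F r d) : mci F r d :=
  (\sum_(i < r) mci_var F r d i) * x.

Lemma mci_raise_is_zmod_morphism : zmod_morphism mci_raise.
Proof. by move=> x y; rewrite /mci_raise mulrBr. Qed.

HB.instance Definition _ := GRing.isZmodMorphism.Build (mci F r d) (mci F r d)
  mci_raise mci_raise_is_zmod_morphism.

Lemma mci_raise_pi p :
  mci_raise (mci_pi F r d p) = mci_pi F r d ((\sum_(i < r) 'X_i) * p).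
Proof. by rewrite mci_piM raddf_sum. Qed.

End Lowering.

(* charF holds in characteristic 0; for a field of arbitrary characteristic the
   claim is false: over 'F_2 with d = (1, 1), (y_1 + y_2) ^+ 2 = 0 in B *)
Theorem theorem6p5 (F : fieldType) (r : nat) (d : 'I_r -> nat) (n : nat)
    (n_def : n = (\sum_(i < r) d i)%N)
    (charF : forall p : nat, p \in [pchar F] -> (n < p)%N)
    (k : nat) (le_k : (k <= n %/ 2)%N) :
  set_bij (mci_comp F r d k) (mci_comp F r d (n - k))
    (fun m : mci F r d => (\sum_(i < r) mci_var F r d i) ^+ (n - 2 * k) * m).
Proof.
(* If [c] vanished in [F], the characteristic would divide [c] and so be at most [n], against
   [charF]. *)
have n_unit c : (0 < c <= n)%N -> c%:R != 0 :> F.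
  case/andP=> c_gt0 le_cn; apply/negP => c0.
  have [p pF] := natf0_pchar c_gt0 c0.
  have := charF p pF; rewrite ltnNge => /negP; apply.
  by apply: leq_trans le_cn; apply: dvdn_leq => //; rewrite (dvdn_pcharf pF).
have -> : (fun m : mci F r d => (\sum_(i < r) mci_var F r d i) ^+ (n - 2 * k) * m)
    = iter (n - 2 * k) (mci_raise F r d).
  apply/funext => m; elim: (_ - _)%N => [|j IHj] /=; first by rewrite mul1r.
  by rewrite -IHj exprS -mulrA.
apply: (raise_bij _ n (mci_comp F r d) (mci_raise F r d) (mci_lower F r d)) => //.
- move=> e _ _ [p hp <-] [q hq <-]; exists (p - q); last exact: raddfB.
  exact: rpredB.
- move=> e _ lt_ne [p hp <-]; rewrite -(raddf0 (mci_pi F r d)).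
  by apply/mci_piE; rewrite subr0; apply: homog_ideal hp; rewrite -n_def.
- move=> e _ [p hp <-]; rewrite /= mci_raise_pi; exists ((\sum_(i < r) 'X_i) * p) => //=.
  rewrite -[e.+1]add1n; apply: dhomogM => //.
  by apply: rpred_sum => i _; rewrite dhomogX /= mdeg1.
- move=> e _ [p hp <-]; rewrite /= mci_lower_pi; exists (mlower F r d p) => //.
  exact: mlower_homog.
- move=> _ [p hp <-]; by rewrite /= mci_lower_pi mlower_homog0 ?raddf0.
- move=> e _ [p hp <-]; rewrite /= mci_raise_pi !mci_lower_pi mci_raise_pi.
  (* Euler's relation turns the last sum into [e] copies of [p], whence the weight [n - 2 e]. *)
  rewrite mlower_mulXsum (euler_homog _ _ _ _ hp) -n_def -addrA raddfD /=.
  congr (_ + _); rewrite -raddfMz mulrzBr !pmulrn; congr (mci_pi F r d (_ - _)).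
  by rewrite -!pmulrn -mulrnA mulnC.
- move=> c x c_n; have [p ->] : exists p, x = mci_pi F r d p.
    by exists (repr x); rewrite -[LHS]reprK.
  rewrite -raddfMn -(raddf0 (mci_pi F r d)) => /mci_piE; rewrite subr0 => cp.
  apply/mci_piE; rewrite subr0.
  have -> : p = (c%:R^-1)%:MP * (p *+ c).
    by rewrite mul_mpolyC -scaler_nat scalerA mulVf ?scale1r ?n_unit.
  exact: idealMr.
- move=> c e _ c_n [p hp <-]; exists (mci_pi F r d (c%:R^-1 *: p)).
    by exists (c%:R^-1 *: p) => //; apply: rpredZ.
  by rewrite -raddfMn -scaler_nat scalerA mulfV ?scale1r ?n_unit.
Qed.
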